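(* Let $\alpha$ be a positive integer with $\alpha\le\max G$, and assume that $\Omega_G(n)\neq 0$ for $n=0,1,2,\ldots$. Let $\{\mathfrak{R}_g\}_{g\in G}$ be the reduced representation of $(q_n)_n$. Then the sequence $(q_n)_n$ only satisfies a three-term recurrence relation $$xq_n(x)=a_nq_{n+1}(x)+b_nq_n(x)+c_nq_{n-1}(x),\qquad n\ge 0,$$ where $(a_n)_n,(b_n)_n,(c_n)_n$ are sequences of real numbers with $c_n\neq 0$ for $n\ge 1$, when $G=\{\alpha,\alpha+1,\ldots,\alpha+m-1\}$ (so $g_h=\alpha+h-1$) and the polynomials $\mathfrak{R}_g$ have the following form: (i) if $\alpha\ge m$, there are real numbers $a_0,\ldots,a_{m-1}$ with $a_0\neq 0$ such that for $h=1,\ldots,m$ $$\mathfrak{R}_{g_h}(x)=\binom{x+\alpha+h-1}{\alpha+h-1}+(h-1)!\sum_{l=0}^{h-1}\frac{(-1)^l a_{h-l-1}}{(\alpha-l)_l}\binom{x+l}{l};$$ (ii) if $\alpha\le m-1$, there are real numbers $\tilde a_{m-\alpha},\ldots,\tilde a_{m-1}$ such that for $h=1,\ldots,m$ $$\mathfrak{R}_{g_h}(x)=\binom{x+\alpha+h-1}{\alpha+h-1}+(h-1)!\sum_{l=0}^{h+\alpha-m-1}\frac{(-1)^l \tilde a_{h-l-1}}{(\alpha-l)_l}\binom{x+l}{l}.$$ Hence, for any other choice of $\mathfrak{R}_g$, $g\in G$, the polynomials $(q_n)_n$ are no longer orthogonal with respect to a measure.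
   Context: The Laguerre polynomials are $L_n^{\alpha}(x)=\sum_{j=0}^n\frac{(-x)^j}{j!}\binom{n+\alpha}{n-j}$ for $n\ge 0$, and $L_n^\alpha=0$ for $n<0$. Here $\binom{y}{k}=y(y-1)\cdots(y-k+1)/k!$, $(a)_k=a(a+1)\cdots(a+k-1)$ with $(a)_0=1$, and a sum $\sum_{l=u}^v$ with $u>v$ is $0$. $G=\{g_1<g_2<\cdots<g_m\}$ is a finite set of $m\ge 1$ positive integers and, for each $g\in G$, $\mathcal{R}_g$ is a real polynomial of degree $g$ with leading coefficient $1/g!$. Put $\Omega_G(x)=\det\left(\mathcal{R}_{g_l}(x-j)\right)_{l,j=1}^m$. The polynomials $(q_n)_{n\ge 0}$ are defined by $$q_n(x)=\begin{vmatrix} L^\alpha_n(x) & L^\alpha_{n-1}(x) & \cdots & L^\alpha_{n-m}(x)\\ \mathcal{R}_{g_1}(n)&\mathcal{R}_{g_1}(n-1)&\cdots&\mathcal{R}_{g_1}(n-m)\\ \vdots&\vdots&\ddots&\vdots\\ \mathcal{R}_{g_m}(n)&\mathcal{R}_{g_m}(n-1)&\cdots&\mathcal{R}_{g_m}(n-m)\end{vmatrix},$$ with $q_{-1}=0$; when $\Omega_G(n)\ne0$ for all $n\ge0$ one has $\deg q_n=n$. The polynomials $q_n$ do not change if each $\mathcal{R}_g$ is replaced by a linear combination $\mathcal{R}_g+\sum_{\tilde g\in G,\,\tilde g<g}\zeta_{g,\tilde g}\mathcal{R}_{\tilde g}$ with real $\zeta_{g,\tilde g}$. The reduced representation $\{\mathfrak{R}_g\}_{g\in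 G}$ of $(q_n)_n$ is the set of polynomials in which $\mathfrak{R}_g$, $g\in G$, is the unique linear combination of this form such that the powers $x^{\tilde g}$, with $\tilde g<g$ and $\tilde g\in G$, do not appear in the expansion of $\mathfrak{R}_g$ in powers of $x$. ''Orthogonal with respect to a measure'' means with respect to a (not necessarily positive) measure $\mu$ on the real line: $\int q_nq_k\,d\mu=0$ for $n\ne k$ and $\int q_n^2\,d\mu\neq0$ for all $n\ge 0$. (By Favard's theorem this is equivalent to a three-term recurrence of the form $xq_n(x)=a_nq_{n+1}(x)+b_nq_n(x)+c_nq_{n-1}(x)$, $n\ge 0$, where $(a_n)_n,(b_n)_n,(c_n)_n$ are sequences of real numbers with $c_n\neq 0$ for $n\ge 1$.)
   Formalization: For m ≥ 2 the displayed polynomials contain powers x^g̃ with g̃ in G, g̃ < g, so they cannot equal the reduced representation; here ''have the following form'' means that the 𝔑_g are the reduced representation of the displayed family. *)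

(* Defs.v *)
From HB Require Import structures.
From mathcomp Require Import all_boot all_order all_algebra.
From mathcomp Require Import all_classical all_reals all_analysis.
Import Order.TTheory GRing.Theory Num.Theory.

Set Implicit Arguments.
Unset Strict Implicit.
Unset Printing Implicit Defensive.

Local Open Scope ring_scope.

(* binom(x, k) as a polynomial in x; the number binom(y, k) is
   (binomp R k).[y] and binom(x + c, k) is binomp R k \Po ('X + c%:P). *)
Definition binomp (R : realType) (k : nat) : {poly R} :=
  (k`!%:R)^-1 *: \prod_(i < k) ('X - (i%:R)%:P).

Definition pochhammer (R : realType) (a : R) (k : nat) : R :=
  \prod_(i < k) (a + i%:R).

Definition laguerre (R : realType) (alpha : R) (n : int) : {poly R} :=
  match n with
  | Posz n => \sum_(j < n.+1)
      ((-1) ^+ j / j`!%:R * (binomp R (n - j)).[n%:R + alpha]) *: 'X^j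
  | Negz _ => 0
  end.

Section LaguerreType.
Variables (R : realType) (m : nat).

(* The set G = {g_1 < ... < g_m} is given by its increasing enumeration
   g : 'I_m -> nat and a family (R_g)_(g in G) by the polynomials of the
   successive elements; indices are shifted by one: l : 'I_m is l + 1. *)
Implicit Types (g : 'I_m -> nat) (Rp Rr : 'I_m -> {poly R}).

Definition Omega Rp (x : R) : R :=
  \det (\matrix_(l < m, j < m) (Rp l).[x - j.+1%:R]).

(* Row 0 holds the Laguerre polynomials, row l + 1 the (constant) values of
   the l-th polynomial of the family. *)
Definition laguerre_type (alpha : R) Rp (n : nat) : {poly R} :=
  \det (\matrix_(i < m.+1, j < m.+1)
    if unlift ord0 i is Some l then ((Rp l).[n%:R - j%:R])%:P
    else laguerre alpha (n%:Z - j%:Z)).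

Definition reduced_representation g Rp Rr : Prop :=
  (exists zeta : 'I_m -> 'I_m -> R,
     forall l, Rr l = Rp l + \sum_(k < m | (k < l)%N) zeta l k *: Rp k) /\
  (forall l k : 'I_m, (k < l)%N -> (Rr l)`_(g k) = 0).

(* The displayed polynomials, h = 1, ..., m, with the sum over l cut at
   l < u. *)
Definition krall_poly (alpha : nat) (a : nat -> R) (u h : nat) : {poly R} :=
  binomp R (alpha + h - 1) \Po ('X + ((alpha + h - 1)%:R)%:P)
  + ((h - 1)`!)%:R *: \sum_(0 <= l < u)
      ((-1) ^+ l * a (h - l - 1)%N / pochhammer (alpha%:R - l%:R) l)
        *: (binomp R l \Po ('X + (l%:R)%:P)).

(* For m >= 2 the displayed polynomials contain powers x^g' with g' < g in G,
   hence they are not themselves reduced: "Rr has the displayed form" means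
   that Rr is the reduced representation of the displayed family. *)
Definition krall_laguerre_form g (alpha : nat) Rr : Prop :=
  [/\ forall l : 'I_m, g l = (alpha + l)%N,
      (m <= alpha)%N -> exists a : nat -> R, a 0%N != 0 /\
        reduced_representation g
          (fun l => krall_poly alpha a l.+1 l.+1) Rr
    & (alpha <= m - 1)%N -> exists a : nat -> R,
        reduced_representation g
          (fun l => krall_poly alpha a (l.+1 + alpha - m) l.+1) Rr].

End LaguerreType.

Definition three_term_recurrence (R : realType) (q : nat -> {poly R}) : Prop :=
  exists a b c : nat -> R,
    (forall n, (1 <= n)%N -> c n != 0) /\
    forall n, 'X * q n = a n *: q n.+1 + b n *: q n
                         + c n *: (if n is n'.+1 then q n' else 0).

Section Orthogonality.
Local Open Scope classical_set_scope.

Definition charge_Rintegral d (T : measurableType d) (R : realType)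
    (nu : {charge set T -> \bar R}) (P N : set T)
    (nuPN : hahn_decomposition nu P N) (f : T -> R) : R :=
  \int[jordan_pos nuPN]_(x in setT) f x - \int[jordan_neg nuPN]_(x in setT) f x.

(* Library charges are finite; this is no restriction, as q_0 is a nonzero
   constant and q_0 ^ 2 has to be integrable. The integral does not depend on
   the Hahn decomposition. *)
Definition orthogonal_wrt_measure (R : realType) (q : nat -> {poly R}) : Prop :=
  exists (nu : {charge set (measurableTypeR R) -> \bar R})
         (P N : set (measurableTypeR R)) (nuPN : hahn_decomposition nu P N),
    [/\ forall n k, (charge_variation nuPN).-integrable setT
          (fun x => ((q n * q k).[x])%:E),
        forall n k, n != k ->
          charge_Rintegral nuPN (fun x => (q n * q k).[x]) = 0
      & forall n, charge_Rintegral nuPN (fun x => (q n * q n).[x]) != 0].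

End Orthogonality.

(* Main.v *)
From HB Require Import structures.
Require Import Defs.
From mathcomp Require Import all_boot all_order all_algebra.
From mathcomp Require Import all_classical all_reals all_analysis.
From mathcomp Require Import measurable_realfun ring zify.
Import Order.TTheory GRing.Theory Num.Theory.
Local Open Scope ring_scope.

Set Implicit Arguments.
Unset Strict Implicit.
Unset Printing Implicit Defensive.

(** The three-term recurrence of the Laguerre polynomials, read on functions of
    the index n, is a difference operator J ([dualx]), and the whole question is
    about the space V spanned by the polynomials R_g.

    Suppose that (q_n) satisfies a three-term recurrence. For R in V, the linear
    functional that sends L_k to R(k) kills q_n for n >= m, since it turns the
    first row of the determinant into a combination of the other ones. Applied
    to the recurrence, it shows that J R, put in the first row, also makes the
    determinant vanish for all n > m. As Omega(n) <> 0, this forces J R to be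
    in V ([dualx_inspan]).

    So V is a finite-dimensional J-stable space of polynomials. In the basis
    b_k = binom(x + k, k) the operator J is the weighted shift
    J b_k = (alpha - k) b_(k-1) ([dualx_multichoose]); it lowers degrees by
    exactly one, except in degrees 0 and alpha. As V contains no nonzero
    constant, its smallest degree is alpha and its degrees are consecutive
    ([dualx_degrees]): G = {alpha, ..., alpha + m - 1}. Moreover V has a Jordan
    chain K_i, with J K_i = - i K_(i-1), compatible with degrees
    ([dual_chain_exists]), and solving this relation coordinate by coordinate
    gives the displayed polynomials, with a_i the coordinate of K_i on
    b_0 divided by i! ([dual_chain_krall]). The reduced representation of the
    chain is that of (q_n), as both are bases of V with the same flag and
    the same leading coefficients.

    The condition a_0 <> 0 says that b_alpha is not in V. If it were, all q_n
    with n >= m would vanish at 0, because L_k(0) = b_alpha(k); as c_n <> 0, the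
    recurrence at 0 read backwards would give q_0 = 0
    ([three_term_not_multichoose]). When alpha < m, the zero of the weight
    alpha - k prevents a chain of length m from having a_0 <> 0
    ([dual_chain_length]): no recurrence with all c_n <> 0 exists then, and this
    case is settled by contradiction.

    Finally, orthogonality with respect to a signed measure gives the recurrence
    by the usual expansion of x q_n ([orthogonal_wrt_measure_three_term]). *)

(** * Orthogonality and three-term recurrences *)

Definition graded (R : realType) (q : nat -> {poly R}) : Prop :=
  forall n, size (q n) = n.+1.

Lemma graded_span (R : realType) (q : nat -> {poly R}) (qG : graded q)
    (n : nat) (p : {poly R}) (sp : (size p <= n)%N) :
  exists e : nat -> R, p = \sum_(k < n) e k *: q k.
Proof.
elim: n p sp => [|n IHn] p sp.
  by exists (fun=> 0); rewrite big_ord0; apply/eqP; rewrite -size_poly_leq0.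
have qn0 : (q n)`_n != 0.
  by have := lead_coef_eq0 (q n); rewrite /lead_coef -size_poly_eq0 qG => ->.
set d := p`_n / (q n)`_n.
have [|e pE] := IHn (p - d *: q n).
  apply/leq_sizeP => j nj; rewrite coefB coefZ.
  case: (eqVneq j n) => [->|jn]; first by rewrite /d divfK // subrr.
  have {}nj : (n < j)%N by lia.
  by rewrite (leq_sizeP _ _ sp) // [(q n)`_j]nth_default ?qG // mulr0 subrr.
exists (fun k => if (k < n)%N then e k else d).
rewrite big_ord_recr /= ltnn; under eq_bigr => i _ do rewrite ltn_ord.
by rewrite -pE subrK.
Qed.

(** The easy half of Favard's theorem, for a moment functional: x q_n is
    orthogonal to q_j for j + 1 < n because x q_j has degree < n, which leaves
    three terms, and the lower coefficient of x q_(n+1) is the coefficient of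
    x q_n on q_(n+1), nonzero by degree, times L (q_(n+1)^2) / L (q_n^2). *)
Lemma orthogonal_three_term (R : realType) (q : nat -> {poly R})
    (L : {scalar {poly R}}) (qG : graded q)
    (qO : forall n k, n != k -> L (q n * q k) = 0)
    (qN : forall n, L (q n * q n) != 0) :
  three_term_recurrence q.
Proof.
have Lsum n j (e : nat -> R) : (j < n)%N ->
    L (q j * \sum_(k < n) e k *: q k) = e j * L (q j * q j).
  move=> jn; rewrite mulr_sumr linear_sum (bigD1 (Ordinal jn)) //=.
  rewrite big1 ?addr0 => [|i ij]; first by rewrite -scalerAr linearZ.
  rewrite -scalerAr linearZ /= qO ?mulr0 //.
  by apply: contra ij => /eqP ji; apply/eqP/val_inj.
have /choice [e eE] n : exists e : nat -> R,
    'X * q n = \sum_(k < n.+2) e k *: q k.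
  apply: graded_span => //; rewrite mulrC size_mulX ?qG //.
  by rewrite -size_poly_eq0 qG.
(* Multiplication by x is symmetric for the bilinear form L (p * r). *)
have swap n j : q j * ('X * q n) = q n * ('X * q j) by rewrite mulrCA; ring.
have e_small n j : (j.+1 < n)%N -> e n j = 0.
  move=> jn; have jn2 : (j < n.+2)%N by lia.
  have /eqP := Lsum n.+2 j (e n) jn2.
  rewrite -eE swap eE mulr_sumr linear_sum big1 => [|i _].
    by rewrite eq_sym mulf_eq0 (negPf (qN j)) orbF => /eqP.
  rewrite -scalerAr linearZ /= qO ?mulr0 //.
  by apply/eqP => ni; have := ltn_ord i; rewrite -ni ltnNge jn.
have e_low n : e n.+1 n != 0.
  have : e n.+1 n * L (q n * q n) != 0.
    rewrite -(Lsum n.+3) ?ltnS ?(leq_trans (leqnSn n)) //.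
    rewrite -eE swap eE (Lsum n.+2) // mulf_neq0 ?qN //.
    apply/eqP => e0; have := eE n; rewrite big_ord_recr /= e0 scale0r addr0.
    move/(congr1 (size \o val)) => /=; rewrite mulrC size_mulX;
      rewrite -?size_poly_eq0 ?qG //.
    move=> sE; suff : (n.+2 <= n.+1)%N by rewrite ltnn.
    rewrite sE; apply: (leq_trans (size_sum _ _ _)).
    apply/bigmax_leqP => i _; apply: (leq_trans (size_scale_leq _ _)).
    by rewrite qG.
  by rewrite mulf_eq0 negb_or => /andP[].
exists (fun n => e n n.+1), (fun n => e n n).
exists (fun n => if n is n'.+1 then e n n' else 0); split => [[//|n] _|n].
  exact: e_low.
rewrite eE !big_ord_recr /= addrC [X in _ + X]addrC addrA; congr (_ + _).
case: n => [|n]; first by rewrite big_ord0 scaler0.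
rewrite big_ord_recr /= big1 ?add0r // => i _.
by rewrite e_small ?scale0r // ltnS.
Qed.

(** Both Jordan parts are dominated by the variation, so that integration
    against the charge is linear on functions integrable for the variation. *)
Lemma charge_variation_integrable d (T : measurableType d) (R : realType)
    (nu : {charge set T -> \bar R}) (P N : set T)
    (nuPN : hahn_decomposition nu P N) (f : T -> \bar R)
    (fI : (charge_variation nuPN).-integrable setT f) :
  (jordan_pos nuPN).-integrable setT f /\ (jordan_neg nuPN).-integrable setT f.
Proof.
move/integrableP : fI => [mf fI].
rewrite (@eq_measure_integral _ _ _ _
  (measure_add (jordan_pos nuPN) (jordan_neg nuPN))) in fI; last first.
  by move=> A mA _; exact/esym/measure_addE.
rewrite ge0_integral_measure_add // in fI; last first.
  exact: measurableT_comp.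
split; apply/integrableP; split=> //; apply: le_lt_trans fI.
  by rewrite leeDl // integral_ge0.
by rewrite leeDr // integral_ge0.
Qed.

Lemma charge_RintegralZ d (T : measurableType d) (R : realType)
    (nu : {charge set T -> \bar R}) (P N : set T)
    (nuPN : hahn_decomposition nu P N) (a : R) (f : T -> R)
    (fI : (charge_variation nuPN).-integrable setT (EFin \o f)) :
  charge_Rintegral nuPN (fun x => a * f x) = a * charge_Rintegral nuPN f.
Proof.
have [fP fN] := charge_variation_integrable fI.
by rewrite /charge_Rintegral !RintegralZl // mulrBr.
Qed.

Lemma charge_RintegralD d (T : measurableType d) (R : realType)
    (nu : {charge set T -> \bar R}) (P N : set T)
    (nuPN : hahn_decomposition nu P N) (f1 f2 : T -> R)
    (f1I : (charge_variation nuPN).-integrable setT (EFin \o f1))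
    (f2I : (charge_variation nuPN).-integrable setT (EFin \o f2)) :
  charge_Rintegral nuPN (fun x => f1 x + f2 x) =
  charge_Rintegral nuPN f1 + charge_Rintegral nuPN f2.
Proof.
have [f1P f1N] := charge_variation_integrable f1I.
have [f2P f2N] := charge_variation_integrable f2I.
by rewrite /charge_Rintegral !RintegralD // opprD addrACA.
Qed.

Lemma orthogonal_wrt_measure_three_term (R : realType) (q : nat -> {poly R})
    (qG : graded q) :
  orthogonal_wrt_measure q -> three_term_recurrence q.
Proof.
move=> [nu [P [N [nuPN [qI qO qN]]]]].
(* q_0 is a nonzero constant, so each q_n = q_n q_0 / q_0 is integrable, and
   the q_n span all polynomials. *)
pose I (p : {poly R}) := (charge_variation nuPN).-integrable setT
  (EFin \o (fun x => p.[x])).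
have ID a p r : I p -> I r -> I (a *: p + r).
  move=> Ip Ir.
  have : (charge_variation nuPN).-integrable setT
      ((fun x => a%:E * (p.[x])%:E) \+ (fun x => (r.[x])%:E))%E.
    by apply: integrableD => //; exact: integrableZl.
  apply: eq_integrable => // x _ /=.
  by rewrite hornerD hornerZ EFinD EFinM.
have I0 : I 0.
  apply: (eq_integrable _ (fun=> 0%E)) => //; last exact: integrable0.
  by move=> x _ /=; rewrite horner0.
have q0E : q 0%N = ((q 0%N)`_0)%:P by apply: size1_polyC; rewrite qG.
have q00 : (q 0%N)`_0 != 0.
  by rewrite -polyC_eq0 -q0E -size_poly_eq0 qG.
have Iq n : I (q n).
  have -> : q n = ((q 0%N)`_0)^-1 *: (q n * q 0%N) + 0.
    by rewrite addr0 q0E mulrC mul_polyC scalerA coefC /= mulVf // scale1r.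
  by apply: ID => //; exact: qI.
have Iall p : I p.
  have [e ->] := graded_span qG (leqnn (size p)).
  elim: (size p) => [|n IHn]; first by rewrite big_ord0.
  by rewrite big_ord_recr /= addrC; exact: ID.
pose M (p : {poly R}) : R := charge_Rintegral nuPN (fun x => p.[x]).
have M_lin : scalar M.
  move=> a p r; rewrite /M -charge_RintegralZ; last exact: Iall.
  have apE : (fun x => a * p.[x]) = (fun x => (a *: p).[x]).
    by apply/funext => x; rewrite hornerZ.
  rewrite apE -charge_RintegralD; [|exact: Iall|exact: Iall].
  by congr charge_Rintegral; apply/funext => x; rewrite hornerD.
pose L : {scalar {poly R}} := HB.pack M (GRing.isLinear.Build _ _ _ _ M M_lin).
exact: (@orthogonal_three_term _ _ L).
Qed.

(** * Polynomials in the basis binom(x + k, k) *)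

Lemma binomp0 (R : realType) (y : R) : (binomp R 0).[y] = 1.
Proof. by rewrite /binomp fact0 big_ord0 invr1 scale1r hornerC. Qed.

Lemma binompE (R : realType) (k : nat) (y : R) :
  k`!%:R * (binomp R k).[y] = \prod_(i < k) (y - i%:R).
Proof.
rewrite /binomp hornerZ horner_prod mulVKf ?pnatr_eq0 -?lt0n ?fact_gt0 //.
by apply: eq_bigr => i _; rewrite hornerXsubC.
Qed.

Lemma binompS (R : realType) (k : nat) (y : R) :
  k.+1%:R * (binomp R k.+1).[y] = (y - k%:R) * (binomp R k).[y].
Proof.
have k0 : k`!%:R != 0 :> R by rewrite pnatr_eq0 -lt0n fact_gt0.
apply: (mulfI k0); rewrite mulrA -natrM mulnC -factS binompE mulrCA binompE.
by rewrite big_ord_recr /= mulrC.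
Qed.

Lemma binomp_shift (R : realType) (k : nat) (y : R) :
  k.+1%:R * (binomp R k.+1).[y + 1] = (y + 1) * (binomp R k).[y].
Proof.
have k0 : k`!%:R != 0 :> R by rewrite pnatr_eq0 -lt0n fact_gt0.
apply: (mulfI k0); rewrite mulrA -natrM mulnC -factS binompE mulrCA binompE.
rewrite big_ord_recl /= subr0; congr (_ * _); apply: eq_bigr => i _.
by rewrite /bump /= add1n -natr1; ring.
Qed.

Lemma binomp_pascal (R : realType) (k : nat) (y : R) :
  (binomp R k.+1).[y + 1] = (binomp R k.+1).[y] + (binomp R k).[y].
Proof.
have k0 : k.+1%:R != 0 :> R by rewrite pnatr_eq0.
apply: (mulfI k0); rewrite binomp_shift mulrDr binompS -natr1; ring.
Qed.

Lemma binomp_nat (R : realType) (k n : nat) :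
  (binomp R k).[n%:R] = 'C(n, k)%:R.
Proof.
elim: n k => [|n IHn] [|k]; rewrite ?binomp0 ?bin0 //.
  have k0 : k.+1%:R != 0 :> R by rewrite pnatr_eq0.
  apply: (mulfI k0); rewrite bin0n mulr0; elim: k k0 => [|k IHk] _.
    by rewrite binompS subrr mul0r.
  rewrite binompS; have k0 : k.+1%:R != 0 :> R by rewrite pnatr_eq0.
  by rewrite [X in _ * X](mulfI k0 (etrans (IHk k0) (esym (mulr0 _)))) mulr0.
by rewrite -natr1 binomp_pascal !IHn binS natrD.
Qed.

Lemma size_binomp (R : realType) (k : nat) : size (binomp R k) = k.+1.
Proof.
rewrite size_scale ?invr_neq0 ?pnatr_eq0 -?lt0n ?fact_gt0 //.
by rewrite size_prod_XsubC /index_enum -enumT size_enum_ord.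
Qed.

Lemma lead_coef_binomp (R : realType) (k : nat) :
  lead_coef (binomp R k) = (k`!%:R)^-1.
Proof. by rewrite lead_coefZ (monicP (monic_prod_XsubC _ _ _)) mulr1. Qed.

Lemma horner_nat_eq0 (R : realType) (p : {poly R}) (N : nat) :
  (forall n, (N <= n)%N -> p.[n%:R] = 0) -> p = 0.
Proof.
move=> p0; apply/eqP/negPn/negP => pn0.
have := @max_poly_roots _ p [seq n%:R | n <- iota N (size p)] pn0.
rewrite size_map size_iota ltnn => H; suff: false by []; apply: H.
  apply/allP => x /mapP[n]; rewrite mem_iota => /andP[Nn _] ->.
  exact/rootP/p0.
by rewrite map_inj_uniq ?iota_uniq // => i j /eqP; rewrite eqr_nat => /eqP.
Qed.

Lemma horner_inj (R : realType) (p q : {poly R}) :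
  (forall x, p.[x] = q.[x]) -> p = q.
Proof.
move=> pq; apply/subr0_eq/(@horner_nat_eq0 _ _ 0%N) => n _.
by rewrite hornerD hornerN pq subrr.
Qed.

Definition multichoose (R : realType) (k : nat) : {poly R} :=
  binomp R k \Po ('X + k%:R%:P).

Lemma horner_multichoose (R : realType) (k : nat) (x : R) :
  (multichoose R k).[x] = (binomp R k).[x + k%:R].
Proof. by rewrite horner_comp hornerD hornerX hornerC. Qed.

Lemma size_multichoose (R : realType) : graded (multichoose R).
Proof. by move=> k; rewrite size_comp_poly2 ?size_XaddC // size_binomp. Qed.

Lemma lead_multichoose (R : realType) (k : nat) :
  (multichoose R k)`_k = (k`!%:R)^-1.
Proof.
rewrite -lead_coef_binomp -[RHS]mulr1 -(expr1n _ (size (binomp R k)).-1).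
rewrite -[X in X ^+ _](lead_coefXaddC (k%:R : R)).
rewrite -lead_coef_comp ?size_XaddC // /lead_coef -/(multichoose R k).
by rewrite size_multichoose.
Qed.

Definition backward (R : realType) (p : {poly R}) : {poly R} :=
  p - (p \Po ('X - 1%:P)).

Lemma horner_backward (R : realType) (p : {poly R}) (x : R) :
  (backward p).[x] = p.[x] - p.[x - 1].
Proof. by rewrite /backward hornerD hornerN horner_comp hornerXsubC. Qed.

Lemma backward_multichoose (R : realType) (k : nat) :
  backward (multichoose R k) = if k is k'.+1 then multichoose R k' else 0.
Proof.
apply: horner_inj => x; rewrite horner_backward !horner_multichoose.
case: k => [|k]; first by rewrite !binomp0 subrr horner0.
rewrite horner_multichoose (_ : x + k.+1%:R = x + k%:R + 1).
  rewrite binomp_pascal (_ : x - 1 + k.+1%:R = x + k%:R); first ring.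
  by rewrite -natr1; ring.
by rewrite -natr1; ring.
Qed.

(** The k-th coordinate in the basis [multichoose]: the backward difference
    sends [multichoose R k.+1] to [multichoose R k], and every element of the
    basis but the first one vanishes at -1, as in Newton's formula. *)
Definition mcoord (R : realType) (k : nat) (p : {poly R}) : R :=
  (iter k (@backward R) p).[-1].

Lemma iter_backwardD (R : realType) (k : nat) (a : R) (p q : {poly R}) :
  iter k (@backward R) (a *: p + q) =
  a *: iter k (@backward R) p + iter k (@backward R) q.
Proof.
elim: k => //= k ->; rewrite /backward linearP /=.
by rewrite scalerBr opprD addrACA.
Qed.

Lemma mcoord_linear (R : realType) (k : nat) : scalar (@mcoord R k).
Proof.
by move=> a p q; rewrite /mcoord iter_backwardD hornerD hornerZ.
Qed.

HB.instance Definition _ (R : realType) (k : nat) :=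
  GRing.isLinear.Build R {poly R} R _ (@mcoord R k) (@mcoord_linear R k).

Lemma mcoord_multichoose (R : realType) (k i : nat) :
  mcoord k (multichoose R i) = (k == i)%:R.
Proof.
have b0 j : (multichoose R j).[-1] = (j == 0%N)%:R.
  rewrite horner_multichoose; case: j => [|j]; first by rewrite binomp0.
  have -> : -1 + j.+1%:R = j%:R :> R by rewrite -natr1; ring.
  by rewrite binomp_nat bin_small.
have it0 j : iter j (@backward R) 0 = 0.
  elim: j => //= j ->; apply: horner_inj => x.
  by rewrite horner_backward !horner0 subrr.
elim: k i => [|k IHk] i; first by rewrite /mcoord /= b0 eq_sym.
rewrite /mcoord iterSr backward_multichoose.
by case: i => [|i]; rewrite ?it0 ?horner0 // -/(mcoord _ _) IHk.
Qed.

Lemma mcoord_expand (R : realType) (n : nat) (p : {poly R})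
    (sp : (size p <= n)%N) :
  p = \sum_(k < n) mcoord k p *: multichoose R k.
Proof.
have [e pE] := graded_span (@size_multichoose R) sp.
rewrite {1}pE; apply: eq_bigr => k _; congr (_ *: _).
rewrite pE linear_sum (bigD1 k) //= linearZ /= mcoord_multichoose eqxx mulr1.
rewrite big1 ?addr0 // => i ik; rewrite linearZ /= mcoord_multichoose.
by rewrite (_ : (_ == _) = false) ?mulr0 //; rewrite eq_sym; exact: negPf ik.
Qed.

Lemma mcoord_eq0 (R : realType) (k : nat) (p : {poly R})
    (sp : (size p <= k)%N) : mcoord k p = 0.
Proof.
rewrite (mcoord_expand sp) linear_sum big1 // => i _.
by rewrite linearZ /= mcoord_multichoose gtn_eqF ?mulr0.
Qed.

Lemma mcoord_lead (R : realType) (k : nat) (p : {poly R})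
    (sp : (size p <= k.+1)%N) : mcoord k p = k`!%:R * p`_k.
Proof.
have k0 : k`!%:R != 0 :> R by rewrite pnatr_eq0 -lt0n fact_gt0.
rewrite [in RHS](mcoord_expand sp) big_ord_recr /= coefD coefZ.
rewrite lead_multichoose coef_sum big1 => [|i _].
  by rewrite add0r mulrC divfK.
by rewrite coefZ [X in _ * X]nth_default ?mulr0 // size_multichoose.
Qed.

Lemma mcoord_inj (R : realType) (p q : {poly R}) :
  (forall k, mcoord k p = mcoord k q) -> p = q.
Proof.
move=> pq; rewrite (mcoord_expand (leq_maxl (size p) (size q))).
rewrite [RHS](mcoord_expand (leq_maxr (size p) (size q))).
by apply: eq_bigr => k _; rewrite pq.
Qed.

(** The action on the index n that mirrors multiplication by x: if a linear
    functional sends every L_n to p(n), then it sends every x L_n, n >= 1, to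
    (dualx p)(n). It is the recurrence of the Laguerre polynomials read on
    functions of n, namely
    -(n + 1) p(n + 1) + (2 n + alpha + 1) p(n) - (n + alpha) p(n - 1),
    written with differences so as to make its effect on degrees visible. *)
Definition dualx (R : realType) (alpha : R) (p : {poly R}) : {poly R} :=
  ('X + alpha%:P) * backward p - ('X + 1%:P) * (p \Po ('X + 1%:P) - p).

Lemma horner_dualx (R : realType) (alpha : R) (p : {poly R}) (x : R) :
  (dualx alpha p).[x] =
  - (x + 1) * p.[x + 1] + (2 * x + alpha + 1) * p.[x] - (x + alpha) * p.[x - 1].
Proof.
rewrite /dualx hornerD hornerN !hornerM horner_backward !hornerD !hornerN.
by rewrite horner_comp !hornerD !hornerX !hornerC; ring.
Qed.

Lemma dualx_linear (R : realType) (alpha : R) : linear (dualx alpha).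
Proof.
move=> a p q; apply: horner_inj => x.
rewrite [RHS]hornerD [X in _ = X + _]hornerZ !horner_dualx.
by rewrite !hornerD !hornerZ; ring.
Qed.

HB.instance Definition _ (R : realType) (alpha : R) :=
  GRing.isLinear.Build R {poly R} {poly R} _ (dualx alpha)
    (dualx_linear alpha).

(** [dualx] is a weighted shift in the basis [multichoose], hence nilpotent on
    polynomials of bounded degree. When alpha is a positive integer, the weight
    that vanishes at k = alpha makes the kernel two-dimensional, spanned by the
    elements of degree 0 and alpha. *)
Lemma dualx_multichoose (R : realType) (alpha : R) (k : nat) :
  dualx alpha (multichoose R k) =
  if k is k'.+1 then (alpha - k%:R) *: multichoose R k' else 0.
Proof.
apply: horner_inj => x; rewrite horner_dualx !horner_multichoose.
case: k => [|k]; first by rewrite !binomp0 horner0; ring.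
rewrite [RHS]hornerZ horner_multichoose.
set z := x + k%:R.
have -> : x + 1 + k.+1%:R = z + 1 + 1 by rewrite -natr1 /z; ring.
have -> : x + k.+1%:R = z + 1 by rewrite -natr1 /z; ring.
have -> : x - 1 + k.+1%:R = z by rewrite -natr1 /z; ring.
have H : (x + 1) * (binomp R k).[z + 1] = (z + 1) * (binomp R k).[z].
  by rewrite -binomp_shift binompS /z; congr (_ * _); ring.
rewrite (binomp_pascal k (z + 1)) (binomp_pascal k z).
move: H (binomp R k.+1).[z] => /=; rewrite -natr1.
move: (binomp R k).[z] (binomp R k).[z + 1] => B C H A.
by rewrite mulrDr [- (x + 1) * C]mulNr H /z; ring.
Qed.

Lemma mcoord_dualx (R : realType) (alpha : R) (k : nat) (p : {poly R}) :
  mcoord k (dualx alpha p) = (alpha - k.+1%:R) * mcoord k.+1 p.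
Proof.
rewrite {1}(mcoord_expand (leqnn (size p))) !linear_sum /=.
have [kp|kp] := ltnP k.+1 (size p); last first.
  rewrite mcoord_eq0 // mulr0 big1 // => i _.
  rewrite !linearZ /= dualx_multichoose; case: i => [[|i] ip] /=.
    by rewrite linear0 mulr0.
  rewrite linearZ /= mcoord_multichoose gtn_eqF ?mulr0 //.
  by rewrite -ltnS (leq_trans ip).
rewrite (bigD1 (Ordinal kp)) //= big1 ?addr0 => [|i ik].
  rewrite !linearZ /= dualx_multichoose linearZ /= mcoord_multichoose eqxx.
  by rewrite mulr1 mulrC.
rewrite !linearZ /= dualx_multichoose; case: i ik => [[|i] ip] /= ik.
  by rewrite linear0 mulr0.
rewrite linearZ /= mcoord_multichoose (_ : (k == i) = false) ?mulr0 //.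
by apply: contraNF ik => /eqP ki; apply/eqP/val_inj; rewrite /= ki.
Qed.

(** * Laguerre polynomials *)

Lemma laguerre_poly (R : realType) (alpha : R) (n : nat) :
  laguerre alpha n = \poly_(j < n.+1)
    ((-1) ^+ j / j`!%:R * (binomp R (n - j)).[n%:R + alpha]).
Proof. by rewrite poly_def. Qed.

Lemma coef_laguerre (R : realType) (alpha : R) (n j : nat) :
  (laguerre alpha n)`_j = if (j <= n)%N then
    (-1) ^+ j / j`!%:R * (binomp R (n - j)).[n%:R + alpha] else 0.
Proof. by rewrite laguerre_poly coef_poly ltnS. Qed.

Lemma size_laguerre (R : realType) (alpha : R) :
  graded (fun n => laguerre alpha n).
Proof.
move=> n; rewrite laguerre_poly size_poly_eq // subnn binomp0 mulr1.
by rewrite mulf_neq0 ?signr_eq0 // invr_eq0 pnatr_eq0 -lt0n fact_gt0.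
Qed.

Lemma coef_X_laguerre (R : realType) (alpha : R) (n j : nat) :
  (j <= n.+1)%N -> ('X * laguerre alpha n)`_j =
    (-1) ^+ j / j`!%:R * (- j%:R * (binomp R (n.+1 - j)).[n%:R + alpha]).
Proof.
case: j => [|j] jn; rewrite coefXM /= ?oppr0 ?mul0r ?mulr0 //.
rewrite coef_laguerre -ltnS jn subSS mulrA; congr (_ * _).
rewrite factS natrM exprS; field.
by rewrite nat1r !pnatr_eq0 -lt0n fact_gt0.
Qed.

(** Coefficientwise this is an identity between binomial coefficients,
    which Pascal's rule and the two absorption rules [binompS] and
    [binomp_shift] reduce to a single one; the coefficients of index n + 1 and
    n + 2, to which fewer terms contribute, are treated apart. *)
Lemma X_laguerre (R : realType) (alpha : R) (n : nat) :
  'X * laguerre alpha n.+1 =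
  - n.+2%:R *: laguerre alpha n.+2
  + (2 * n.+1%:R + alpha + 1) *: laguerre alpha n.+1
  - (n.+1%:R + alpha) *: laguerre alpha n.
Proof.
apply/polyP => j; rewrite coefB coefD !coefZ !coef_laguerre.
have [jn|nj] := leqP j n.+2; last first.
  rewrite coefXM; case: j nj => // j nj; rewrite coef_laguerre /=.
  by rewrite !ifF ?mulr0 ?addr0 ?subr0 //; apply/negbTE; lia.
rewrite coef_X_laguerre //; set s := (-1) ^+ j / _.
set y := n.+1%:R + alpha.
have yE : n.+2%:R + alpha = y + 1 by rewrite /y -[n.+2%:R]natr1; ring.
have yE' : n%:R + alpha = y - 1 by rewrite /y -[n.+1%:R]natr1; ring.
rewrite yE yE'.
have [jn1|nj1] := leqP j n.+1; last first.
  have -> : j = n.+2 by apply/eqP; rewrite eqn_leq jn.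
  by rewrite subnn ltnNge leqnSn /= !binomp0; ring.
have [jn0|nj0] := leqP j n; last first.
  have -> : j = n.+1 by apply/eqP; rewrite eqn_leq jn1.
  rewrite subSnn subnn -[y + 1]/(y + 1) binomp_pascal !binomp0.
  have -> : (binomp R 1).[y] = y.
    by have := binompS 0 y; rewrite binomp0 mul1r subr0 mulr1.
  by rewrite -[n.+2%:R]natr1 /y -[n.+1%:R]natr1; ring.
rewrite !subSn //; set i := (n - j)%N.
have nE : n.+1%:R = i%:R + j%:R + 1 :> R by rewrite -natr1 -natrD subnK.
rewrite binomp_pascal.
have H1 := binomp_shift i (y - 1); rewrite subrK in H1.
have H2 := binompS i.+1 y.
rewrite -[n.+2%:R]natr1 nE; move: H1 H2.
rewrite -[i.+2%:R]natr1 -[i.+1%:R]natr1.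
have -> : alpha = y - (i%:R + j%:R + 1) by rewrite -nE /y; ring.
move: (binomp R i.+2).[y] (binomp R i.+1).[y] (binomp R i).[y - 1].
move=> A B C H1 H2.
transitivity (s * (- (i%:R + j%:R + 1 + 1) * A + (i%:R + 1 + 1) * A)).
  by ring.
transitivity (s * (- (i%:R + j%:R + 1 + 1) * (A + B)
    + (i%:R + j%:R + 1 + 1 + y) * B - y * C)); last by ring.
by rewrite H2 -H1; ring.
Qed.

(** The values of the Laguerre polynomials at 0 are those of the polynomial
    of degree alpha in the kernel of [dualx]. *)
Lemma laguerre_at0 (R : realType) (alpha n : nat) :
  (laguerre (alpha%:R : R) n).[0] = (multichoose R alpha).[n%:R].
Proof.
rewrite horner_coef0 coef_laguerre expr0 fact0 divr1 mul1r subn0.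
rewrite horner_multichoose -natrD !binomp_nat -[in RHS]bin_sub ?leq_addl //.
by rewrite addnK.
Qed.

(** Adding a multiple of the form p |-> p_N corrects the value at q_N without
    changing the values at the previous polynomials; the bound N makes finitely
    many corrections enough. *)
Lemma graded_functional (R : realType) (q : nat -> {poly R}) (qG : graded q)
    (v : nat -> R) (N : nat) :
  exists phi : {scalar {poly R}}, forall k, (k < N)%N -> phi (q k) = v k.
Proof.
elim: N => [|N [phi phiE]].
  (* Any linear functional would do here. *)
  by exists (@mcoord R 0).
have qN : (q N)`_N != 0.
  by have := lead_coef_eq0 (q N); rewrite /lead_coef -size_poly_eq0 qG => ->.
set c := (v N - phi (q N)) / (q N)`_N.
pose f (p : {poly R}) : R := phi p + c * p`_N.
have fl : scalar f by move=> a p r; rewrite /f linearP coefD coefZ /=; ring.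
pose g : {scalar {poly R}} := HB.pack f (GRing.isLinear.Build _ _ _ _ f fl).
exists g => k; rewrite -[g _]/(f _).
rewrite ltnS leq_eqVlt => /predU1P[->|kN].
  by rewrite /f /c divfK // addrCA subrr addr0.
by rewrite /f phiE // nth_default ?qG // mulr0 addr0.
Qed.

(** * The invariant space spanned by the polynomials of the determinant *)

Definition casorati (R : realType) (m : nat) (Rp : 'I_m -> {poly R}) (n : nat)
    (v : 'I_m.+1 -> R) : 'M[R]_m.+1 :=
  \matrix_(i < m.+1, j < m.+1)
    if unlift ord0 i is Some l then (Rp l).[n%:R - j%:R] else v j.

(** The coefficients of q_n on L_n, L_(n-1), ..., L_(n-m); they are scalars,
    since they only involve the rows of constants. *)
Definition cas_cofactor (R : realType) (m : nat) (Rp : 'I_m -> {poly R})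
    (n : nat) (j : 'I_m.+1) : R :=
  cofactor (casorati Rp n (fun=> 0)) ord0 j.

Lemma casorati_det (R : realType) (m : nat) (Rp : 'I_m -> {poly R}) (n : nat)
    (v : 'I_m.+1 -> R) :
  \det (casorati Rp n v) = \sum_j cas_cofactor Rp n j * v j.
Proof.
rewrite (expand_det_row _ ord0); apply: eq_bigr => j _.
rewrite mxE unlift_none mulrC; congr (_ * _).
rewrite /cas_cofactor /cofactor; congr (_ * \det _).
by apply/matrixP => i k; rewrite !mxE liftK.
Qed.

Lemma laguerre_typeE (R : realType) (m : nat) (alpha : R)
    (Rp : 'I_m -> {poly R}) (n : nat) :
  laguerre_type alpha Rp n =
  \sum_j cas_cofactor Rp n j *: laguerre alpha (n%:Z - (j : nat)%:Z).
Proof.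
rewrite /laguerre_type (expand_det_row _ ord0); apply: eq_bigr => j _.
rewrite mxE unlift_none mulrC -mul_polyC; congr (_ * _).
rewrite /cas_cofactor -cofactor_map_mx /cofactor; congr (_ * \det _).
by apply/matrixP => i k; rewrite !mxE liftK.
Qed.

Lemma cas_cofactor0 (R : realType) (m : nat) (Rp : 'I_m -> {poly R}) (n : nat) :
  cas_cofactor Rp n ord0 = Omega Rp n%:R.
Proof.
rewrite /cas_cofactor /cofactor expr0 mul1r /Omega; congr (\det _).
by apply/matrixP => i k; rewrite !mxE liftK lift0.
Qed.

Lemma cas_cofactor_annihil (R : realType) (m : nat) (Rp : 'I_m -> {poly R})
    (n : nat) (l : 'I_m) :
  \sum_j cas_cofactor Rp n j * (Rp l).[n%:R - j%:R] = 0.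
Proof.
rewrite -(casorati_det Rp n (fun j => (Rp l).[n%:R - j%:R])).
apply: (determinant_alternate (i1 := ord0) (i2 := lift ord0 l)) => // j.
by rewrite !mxE unlift_none liftK.
Qed.

(** The degree is that of L_n, whose coefficient in q_n is Omega n. *)
Lemma size_laguerre_type (R : realType) (m : nat) (alpha : R)
    (Rp : 'I_m -> {poly R}) (Omega_neq0 : forall n : nat, Omega Rp n%:R != 0) :
  graded (laguerre_type alpha Rp).
Proof.
move=> n; rewrite laguerre_typeE big_ord_recl cas_cofactor0 subr0.
rewrite size_polyDl size_scale ?size_laguerre // ltnS.
apply: (leq_trans (size_sum _ _ _)); apply/bigmax_leqP => i _.
apply: (leq_trans (size_scale_leq _ _)).
rewrite lift0; case: (leqP i.+1 n) => [le_in|lt_ni].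
  by rewrite subzn // size_laguerre ltn_subrL /=; exact: leq_trans le_in.
have -> : n%:Z - i.+1%:Z = Negz (i - n).
  by rewrite NegzE; lia.
by rewrite size_poly0.
Qed.

(** Polynomial solutions of the difference equation with coefficients
    [cas_cofactor] are in the span of the family: Omega (m + 1) <> 0 allows an
    element of the span to agree with f at 1, ..., m, and Omega n <> 0 says that
    the leading coefficient of the equation never vanishes, so that the two
    agree at every later integer. *)
Lemma cas_annihil_inspan (R : realType) (m : nat) (Rp : 'I_m -> {poly R})
    (Omega_neq0 : forall n : nat, Omega Rp n%:R != 0) (f : {poly R})
    (fA : forall n, (m < n)%N ->
       \sum_j cas_cofactor Rp n j * f.[n%:R - j%:R] = 0) :
  exists z : 'I_m -> R, f = \sum_k z k *: Rp k.
Proof.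
pose M := \matrix_(l < m, j < m) (Rp l).[m.+1%:R - j.+1%:R].
have Mu : M \in unitmx by rewrite unitmxE unitfE; exact: Omega_neq0.
pose z := (\row_j f.[m.+1%:R - j.+1%:R]) *m invmx M.
exists (z ord0); apply/subr0_eq.
set d := _ - _.
have dA n : (m < n)%N -> \sum_j cas_cofactor Rp n j * d.[n%:R - j%:R] = 0.
  move=> mn; under eq_bigr => j _ do rewrite /d hornerD hornerN mulrBr.
  rewrite sumrB fA // sub0r; apply/eqP; rewrite oppr_eq0; apply/eqP.
  under eq_bigr => j _ do rewrite horner_sum mulr_sumr.
  rewrite exchange_big big1 // => l _.
  under eq_bigr => j _ do rewrite hornerZ mulrCA.
  by rewrite -mulr_sumr cas_cofactor_annihil mulr0.
have d0 (j : 'I_m) : d.[m.+1%:R - j.+1%:R] = 0.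
  have : (z *m M) ord0 j = f.[m.+1%:R - j.+1%:R] by rewrite mulmxKV // mxE.
  rewrite mxE /d hornerD hornerN => <-; rewrite horner_sum; apply/eqP.
  by rewrite subr_eq0; apply/eqP/eq_bigr => l _; rewrite hornerZ [M _ _]mxE.
apply: (@horner_nat_eq0 _ _ 1%N) => n.
elim/ltn_ind: n => n IHn n_gt0; have [mn|nm] := ltnP m n; last first.
  have jm : (m - n < m)%N by lia.
  have := d0 (Ordinal jm); rewrite -natrB /=; last by lia.
  by rewrite subSS subKn.
have := dA n mn; rewrite big_ord_recl big1 => [|j _].
  rewrite addr0 subr0 cas_cofactor0 => /eqP.
  by rewrite mulf_eq0 (negPf (Omega_neq0 n)) => /eqP.
have jn : (j.+1 < n)%N by apply: leq_trans mn; rewrite ltnS.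
rewrite lift0 -natrB ?(ltnW jn) // IHn ?mulr0 //; lia.
Qed.

(** The functional sending L_k to R_l(k) kills every q_n with n >= m, because
    the determinant becomes one with two equal rows; so for n > m it kills the
    right-hand side of the recurrence, hence x q_n. By [X_laguerre] its value on
    x q_n is the determinant with first row the values of dualx R_l. *)
Lemma dualx_inspan (R : realType) (m : nat) (alpha : R)
    (Rp : 'I_m -> {poly R})
    (Omega_neq0 : forall n : nat, Omega Rp n%:R != 0)
    (ttr : three_term_recurrence (laguerre_type alpha Rp)) (l : 'I_m) :
  exists z : 'I_m -> R, dualx alpha (Rp l) = \sum_k z k *: Rp k.
Proof.
move: ttr => [a [b [c [_ ttr]]]].
apply: cas_annihil_inspan => // n mn.
have [phi phiE] := graded_functional (size_laguerre alpha)
  (fun k => (Rp l).[k%:R]) n.+2.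
have phi_q n' : (m <= n' <= n.+1)%N -> phi (laguerre_type alpha Rp n') = 0.
  move=> /andP[mn' n'n]; rewrite -(cas_cofactor_annihil Rp n' l).
  rewrite laguerre_typeE linear_sum; apply: eq_bigr => j _.
  have jn' : (j <= n')%N by apply: leq_trans mn'; rewrite -ltnS.
  by rewrite linearZ /= subzn // phiE ?natrB // ltnS (leq_trans (leq_subr _ _)).
transitivity (phi ('X * laguerre_type alpha Rp n)); last first.
  rewrite ttr !linearD !linearZ /= !phi_q ?mulr0 ?addr0 ?add0r; try lia.
  by case: n mn phi_q {phiE} => // n mn phi_q; rewrite phi_q ?mulr0 //; lia.
rewrite laguerre_typeE mulr_sumr linear_sum; apply: eq_bigr => j _.
have jn : (j < n)%N by apply: leq_trans mn; rewrite ltnS -ltnS.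
rewrite -scalerAr linearZ /= subzn ?(ltnW jn) // -natrB ?(ltnW jn) //.
congr (_ * _); have kn : (n - j <= n)%N by rewrite leq_subr.
case: (n - j)%N (subn_gt0 j n) kn => [|k]; first by rewrite jn.
have phi3 x y z p q r : phi (x *: p + y *: q - z *: r) =
    x * phi p + y * phi q - z * phi r.
  by rewrite linearB linearD !linearZ.
move=> _ kn; rewrite X_laguerre horner_dualx phi3 !phiE; try lia.
have -> : k.+1%:R - 1 = k%:R :> R by rewrite -natr1 addrK.
by rewrite natr1.
Qed.

(** * Jordan chains of the dual operator *)

(** The family is indexed by nat so that its initial segments need no casts. *)
Definition in_span (R : realType) (r : nat -> {poly R}) (h : nat)
    (p : {poly R}) : Prop :=
  exists z : nat -> R, p = \sum_(k < h) z k *: r k.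

Lemma in_spanD (R : realType) (r : nat -> {poly R}) (h : nat) (a : R)
    (p q : {poly R}) :
  in_span r h p -> in_span r h q -> in_span r h (a *: p + q).
Proof.
move=> [y ->] [z ->]; exists (fun k => a * y k + z k).
rewrite scaler_sumr -big_split; apply: eq_bigr => k _ /=.
by rewrite scalerDl scalerA.
Qed.

Lemma in_span0 (R : realType) (r : nat -> {poly R}) (h : nat) : in_span r h 0.
Proof. by exists (fun=> 0); rewrite big1 // => k _; rewrite scale0r. Qed.

Lemma in_spanS (R : realType) (r : nat -> {poly R}) (h h' : nat)
    (p : {poly R}) :
  (h <= h')%N -> in_span r h p -> in_span r h' p.
Proof.
move=> hh' [z ->]; exists (fun k => if (k < h)%N then z k else 0).
rewrite (big_ord_widen h' (fun k => z k *: r k)) // big_mkcond.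
by apply: eq_bigr => k _; case: ifP; rewrite ?scale0r.
Qed.

Lemma in_span_gen (R : realType) (r : nat -> {poly R}) (h k : nat) :
  (k < h)%N -> in_span r h (r k).
Proof.
move=> kh; exists (fun i => (i == k)%:R).
rewrite (bigD1 (Ordinal kh)) //= eqxx scale1r big1 ?addr0 // => i ik.
rewrite (_ : (_ == _) = false) ?scale0r //.
by apply: contraNF ik => /eqP ik; apply/eqP/val_inj.
Qed.

Lemma in_span_trans (R : realType) (r s : nat -> {poly R}) (h h' : nat)
    (p : {poly R}) :
  (forall k, (k < h)%N -> in_span s h' (r k)) ->
  in_span r h p -> in_span s h' p.
Proof.
move=> rs [z ->]; elim: h rs => [|h IHh] rs.
  by rewrite big_ord0; exact: in_span0.
rewrite big_ord_recr /= addrC; apply: in_spanD; first exact: rs.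
by apply: IHh => k kh; apply: rs; exact: ltnW.
Qed.

(** Degrees g l and leading coefficients 1 / (g l)!, read on the coordinates
    [mcoord], for which no size of polynomials has to be computed. *)
Definition staircase (R : realType) (g : nat -> nat) (r : nat -> {poly R})
    (m : nat) : Prop :=
  forall l, (l < m)%N ->
    mcoord (g l) (r l) = 1 /\ forall k, (g l < k)%N -> mcoord k (r l) = 0.

Lemma staircase_mcoord0 (R : realType) (g : nat -> nat) (r : nat -> {poly R})
    (m h n : nat) (p : {poly R}) :
  staircase g r m -> (h <= m)%N -> (forall l, (l < h)%N -> (g l < n)%N) ->
  in_span r h p -> mcoord n p = 0.
Proof.
move=> rS hm gn [z ->]; rewrite linear_sum big1 // => l _.
have [_ r0] := rS l (leq_trans (ltn_ord l) hm).
by rewrite linearZ /= r0 ?mulr0 // gn.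
Qed.

(** The top coordinate of a combination is its last coefficient, so the
    elements of the span of small degree only involve the first generators. *)
Lemma staircase_truncate (R : realType) (g : nat -> nat) (r : nat -> {poly R})
    (m n h : nat) (p : {poly R}) :
  staircase g r m ->
  (forall k l, (k < l)%N -> (l < m)%N -> (g k < g l)%N) ->
  (h <= n)%N -> (n <= m)%N ->
  in_span r n p -> (forall l, (h <= l)%N -> (l < n)%N -> mcoord (g l) p = 0) ->
  in_span r h p.
Proof.
move=> rS gI; elim: n => [|n IHn] hn nm pn p0.
  by move: hn; rewrite leqn0 => /eqP ->.
move: hn; rewrite leq_eqVlt => /predU1P[-> //|]; rewrite ltnS => hn.
apply: IHn => //; [exact: ltnW| |by move=> l hl ln; apply: p0; rewrite // ltnW].
move: pn p0 => [z ->] p0; have := p0 n hn (ltnSn n).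
rewrite big_ord_recr /= linearD linearZ /= (rS n nm).1 mulr1.
rewrite (@staircase_mcoord0 _ g r m n) //;
  [|exact: ltnW|by move=> l ln; exact: gI|by exists z].
by rewrite add0r => ->; rewrite scale0r addr0; exists z.
Qed.

Section DualChain.
Variables (R : realType) (alpha m : nat) (g : nat -> nat) (r : nat -> {poly R}).
Hypotheses (m_gt0 : (0 < m)%N) (g_gt0 : forall l, (l < m)%N -> (0 < g l)%N).
Hypothesis g_incr : forall k l, (k < l)%N -> (l < m)%N -> (g k < g l)%N.
Hypothesis rS : staircase g r m.
Hypothesis rJ : forall l, (l < m)%N -> in_span r m (dualx alpha%:R (r l)).

Local Notation J := (dualx (alpha%:R : R)).

Lemma dualx_lower l : (l < m)%N -> in_span r l (J (r l)).
Proof.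
move=> lm.
apply: (staircase_truncate rS g_incr (ltnW lm) (leqnn m)) => [|k lk km].
  exact: rJ.
rewrite mcoord_dualx (rS lm).2 ?mulr0 // ltnS.
by move: lk; rewrite leq_eqVlt => /predU1P[-> //|lk]; exact/ltnW/g_incr.
Qed.

(** An element of degree k is sent by [dualx] to degree exactly k - 1, unless
    k is 0 or alpha. The element of least positive degree is thus killed, which
    forces its degree to be alpha; the next ones cannot leave a gap below
    them, since their images lie in the span of the previous ones. *)
Lemma dualx_degrees l : (l < m)%N -> g l = (alpha + l)%N.
Proof.
have topJ k : (k < m)%N -> mcoord (g k).-1 (J (r k)) = alpha%:R - (g k)%:R.
  by move=> km; rewrite mcoord_dualx prednK ?g_gt0 // (rS km).1 mulr1.
have g0 : g 0%N = alpha.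
  have := topJ 0%N m_gt0; have [z ->] := dualx_lower m_gt0.
  rewrite big_ord0 linear0 => /esym/eqP; rewrite subr_eq0 eqr_nat => /eqP.
  by [].
elim: l => [|l IHl] lm; first by rewrite addn0.
have ag : (alpha < g l.+1)%N by rewrite -g0; exact: g_incr.
apply/eqP; rewrite eqn_leq addnS -(IHl (ltnW lm)) g_incr // andbT.
rewrite leqNgt; apply/negP => gg; have := topJ _ lm.
rewrite (staircase_mcoord0 rS (ltnW lm) _ (dualx_lower lm)) => [/esym/eqP|k kl].
  by rewrite subr_eq0 eqr_nat ltn_eqF.
have : (g k <= g l)%N.
  move: kl; rewrite ltnS leq_eqVlt => /predU1P[-> //|kl].
  by apply/ltnW/g_incr => //; exact: ltnW.
by move: gg; lia.
Qed.

(** A basis adapted to [dualx] and to the flag. The polynomial K i is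
    determined by K (i - 1) up to the kernel of [dualx]: the condition on the
    coordinate of index alpha removes one degree of freedom, and the coordinate
    of index 0 is the free parameter a_i of the theorem, times i!. *)
Definition dual_chain (h : nat) (K : nat -> {poly R}) : Prop :=
  forall i, (i < h)%N ->
    [/\ in_span r i.+1 (K i), mcoord (alpha + i) (K i) = 1,
        mcoord alpha (K i) = (i == 0%N)%:R
      & J (K i) = - i%:R *: K i.-1].

Lemma dual_chain_span h K : (h <= m)%N -> dual_chain h K ->
  forall i p, (i <= h)%N -> in_span r i p -> in_span K i p.
Proof.
move=> hm Kc; elim=> [|i IHi] p ih [z ->].
  by rewrite big_ord0; exact: in_span0.
have im : (i < m)%N by exact: leq_trans hm.
rewrite big_ord_recr /= addrC -(subrK (K i) (r i)) scalerDr.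
have [Ki K1 _ _] := Kc i ih.
rewrite -addrA; apply: in_spanD; last first.
  apply: in_spanD; first exact: in_span_gen.
  by apply: (in_spanS (leqnSn i)); apply: IHi; [exact: ltnW|exists z].
apply: (in_spanS (leqnSn i)); apply: IHi; first exact: ltnW.
apply: (staircase_truncate rS g_incr (leqnSn i) im) => [|l il li].
  rewrite -[r i - K i]addrC -scaleN1r.
  by apply: in_spanD => //; exact: in_span_gen.
have -> : l = i by apply/eqP; rewrite eqn_leq il andbT -ltnS.
by rewrite linearB /= (rS im).1 dualx_degrees // K1 subrr.
Qed.

(** The image of r_(h+1) lies in the span of the chain already built, with
    leading part -(h+1) K_h; the other terms are images of elements of the
    chain, and are removed by subtracting these. *)
Lemma dual_chain_exists h : (h < m)%N -> exists K, dual_chain h.+1 K.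
Proof.
have rtop k : (k < m)%N -> mcoord (alpha + k) (r k) = 1.
  by move=> km; rewrite -dualx_degrees // (rS km).1.
elim: h => [|h IHh] hm.
  exists r => -[|//] _; split; rewrite ?oppr0 ?scale0r ?addn0 //.
  - exact: in_span_gen.
  - by rewrite -[X in mcoord X]addn0 rtop.
  - by rewrite -[X in mcoord X]addn0 rtop.
  - by have [z ->] := dualx_lower m_gt0; rewrite big_ord0.
have [K Kc] := IHh (ltnW hm).
have [z zE] := dual_chain_span (ltnW hm) Kc (leqnn _) (dualx_lower hm).
have z_top : z h = - h.+1%:R.
  have := congr1 (mcoord (alpha + h)) zE.
  rewrite mcoord_dualx -addnS rtop // mulr1 big_ord_recr /= linearD linearZ /=.
  have [_ -> _ _] := Kc h (ltnSn h); rewrite mulr1.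
  rewrite linear_sum big1 ?add0r => [<-|i _].
    by rewrite natrD opprD addrA subrr sub0r.
  have ih := ltn_ord i; rewrite linearZ /=.
  rewrite (staircase_mcoord0 rS (h := i.+1)) ?mulr0 //.
  - by lia.
  - by move=> l li; rewrite dualx_degrees; lia.
  - by have [] := Kc i (ltnW ih).
pose s := r h.+1 + \sum_(k < h) (z k / k.+1%:R) *: K k.+1.
have Js : J s = - h.+1%:R *: K h.
  rewrite /s linearD /= zE big_ord_recr /= z_top addrAC linear_sum.
  rewrite -big_split big1 ?add0r //.
  move=> k _ /=; have [_ _ _] := Kc k.+1 (ltn_ord k); rewrite linearZ /= => ->.
  by rewrite scalerA mulrN divfK ?pnatr_eq0 // -scalerDl subrr scale0r.
have tailS : in_span r h.+1 (\sum_(k < h) (z k / k.+1%:R) *: K k.+1).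
  apply: (in_span_trans (r := fun k => K k.+1) (h := h)) => [k kh|].
    by apply: (in_spanS (_ : k.+2 <= h.+1)%N) => //; have [] := Kc k.+1 kh.
  by exists (fun k => z k / k.+1%:R).
have K0 := Kc 0%N isT.
have top0 p : in_span r h.+1 p -> mcoord (alpha + h.+1) p = 0.
  apply: (staircase_mcoord0 rS (ltnW hm)) => l lh.
  by rewrite dualx_degrees; lia.
(* K 0 is in the kernel and has coordinate 1 at alpha. *)
pose K' := - mcoord alpha s *: K 0%N + s.
exists (fun i => if i == h.+1 then K' else K i) => i; rewrite ltnS leq_eqVlt.
case: eqVneq => [-> _|ih /= {}ih]; last first.
  by rewrite ifF; [exact: Kc|apply/negbTE; lia].
have [K0S _ K0a JK0] := K0.
have K0S' : in_span r h.+1 (K 0%N) by apply: in_spanS K0S.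
split.
- apply: in_spanD; first exact: in_spanS K0S'.
  rewrite /s -[r h.+1]scale1r; apply: in_spanD; first exact: in_span_gen.
  exact: in_spanS tailS.
- rewrite /K' linearP /= top0 // mulr0 add0r /s linearD /= rtop //.
  by rewrite top0 // addr0.
- by rewrite /K' linearP /= K0a mulr1 addNr.
- by rewrite /K' linearP /= JK0 oppr0 scale0r scaler0 add0r Js ifF //; lia.
Qed.

Hypothesis b_notin : ~ in_span r m (multichoose R alpha).

Section Coordinates.
Variable K : nat -> {poly R}.
Hypothesis Kc : dual_chain m K.

(** Comparing coordinates in J (K i) = - i K (i - 1) gives a recursion whose
    only singular index is k + 1 = alpha. Below and above it, the recursion
    determines everything from the coordinates of index 0 and alpha. *)
Lemma dual_chain_step i k : (i < m)%N ->
  (alpha%:R - k.+1%:R) * mcoord k.+1 (K i) = - i%:R * mcoord k (K i.-1).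
Proof.
move=> im; have [_ _ _ /(congr1 (mcoord k))] := Kc im.
by rewrite mcoord_dualx linearZ.
Qed.

Lemma dual_chain_high i k : (i < m)%N -> (alpha <= k)%N ->
  mcoord k (K i) = (k == alpha + i)%N%:R.
Proof.
elim: k i => [|k IHk] i im; first rewrite leqn0.
  move=> /eqP a0; have [_ _] := Kc im; rewrite a0 add0n => -> _.
  by rewrite eq_sym.
rewrite leq_eqVlt => /predU1P[ak|ak].
  by have [_ _] := Kc im; rewrite ak => -> _; congr (_%:R); lia.
have nz : alpha%:R - k.+1%:R != 0 :> R by rewrite subr_eq0 eqr_nat; lia.
apply: (mulfI nz); rewrite dual_chain_step //.
case: i im => [|i] im; first by rewrite oppr0 mul0r addn0 gtn_eqF ?mulr0.
rewrite /= IHk ?(ltnW im) // addnS eqSS.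
case: eqP => [->|]; last by rewrite !mulr0.
by rewrite !mulr1 -addnS natrD opprD addrA subrr sub0r.
Qed.

Lemma dual_chain_low i k : (i < m)%N -> (k < alpha)%N ->
  mcoord k (K i) = if (k <= i)%N then
    i`!%:R * ((-1) ^+ k * (mcoord 0 (K (i - k)) / (i - k)`!%:R)
              / pochhammer (alpha%:R - k%:R) k) else 0.
Proof.
elim: k i => [|k IHk] i im ka.
  rewrite leq0n subn0 /pochhammer big_ord0 expr0 divr1 mul1r mulrC divfK //.
have nz : alpha%:R - k.+1%:R != 0 :> R by rewrite subr_eq0 eqr_nat; lia.
apply: (mulfI nz); rewrite dual_chain_step //.
case: i im => [|i] im; first by rewrite oppr0 mul0r mulr0.
rewrite /= IHk ?(ltnW im) ?(ltnW ka) // ltnS.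
case: ifP => ki; last by rewrite !mulr0.
have -> : pochhammer (alpha%:R - k.+1%:R) k.+1 =
    (alpha%:R - k.+1%:R) * pochhammer (alpha%:R - k%:R : R) k.
  rewrite /pochhammer big_ord_recl addr0; congr (_ * _); apply: eq_bigr => j _.
  by rewrite lift0 -!natr1; ring.
rewrite subSS factS natrM exprS invfM.
move: (pochhammer _ _)^-1 nz => P.
move: (alpha%:R - k.+1%:R) => x x0; field.
by rewrite x0 pnatr_eq0 -lt0n fact_gt0.
Qed.

Lemma mcoord_krall (a : nat -> R) (i k : nat) :
  mcoord k (krall_poly alpha a i.+1 i.+1) = (k == alpha + i)%N%:R
    + if (k <= i)%N then
        i`!%:R * ((-1) ^+ k * a (i - k)%N / pochhammer (alpha%:R - k%:R) k)
      else 0.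
Proof.
have -> : krall_poly alpha a i.+1 i.+1 = multichoose R (alpha + i)
    + i`!%:R *: \sum_(l < i.+1)
        ((-1) ^+ l * a (i - l)%N / pochhammer (alpha%:R - l%:R) l)
        *: multichoose R l.
  have E j : (j + i.+1 - 1 = j + i)%N by rewrite addnS subn1.
  rewrite /krall_poly E (E 0%N) big_mkord; congr (_ + _ *: _).
  by apply: eq_bigr => l _; rewrite -subnDA addn1 subSS.
rewrite linearD linearZ /= mcoord_multichoose; congr (_ + _).
rewrite linear_sum; have [ki|ik] := leqP k i; last first.
  rewrite big1 ?mulr0 // => l _; rewrite linearZ /= mcoord_multichoose.
  by rewrite gtn_eqF ?mulr0 //; apply: leq_trans ik.
rewrite (bigD1 (Ordinal (ki : (k < i.+1)%N))) //= linearZ /= mcoord_multichoose.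
rewrite eqxx mulr1 big1 ?addr0 => [|l lk]; first by [].
rewrite linearZ /= mcoord_multichoose (_ : (_ == _) = false) ?mulr0 //.
by apply: contraNF lk => /eqP kl; apply/eqP/val_inj; rewrite /= kl.
Qed.

Lemma dual_chain_const_neq0 : mcoord 0 (K 0%N) != 0.
Proof.
apply/eqP => K00; apply: b_notin.
rewrite (_ : multichoose R alpha = K 0%N).
  by have [K0 _ _ _] := Kc m_gt0; exact: in_spanS K0.
apply: mcoord_inj => k; rewrite mcoord_multichoose.
have [ak|ka] := leqP alpha k; first by rewrite dual_chain_high // addn0.
rewrite dual_chain_low // ltn_eqF // leqn0; case: eqP => // ->.
by rewrite K00 mul0r mulr0 mul0r mulr0.
Qed.

Hypothesis alpha_gt0 : (0 < alpha)%N.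

(** If the chain had more than alpha elements, the weight of the shift that
    vanishes would force the coordinate alpha - 1 of K (alpha - 1) to be zero;
    but that coordinate is a nonzero multiple of the coordinate of index
    0 of K 0, which is not zero. *)
Lemma dual_chain_length : (m <= alpha)%N.
Proof.
rewrite leqNgt; apply/negP => am.
have := @dual_chain_step alpha alpha.-1 am.
rewrite prednK // subrr mul0r => /esym/eqP.
rewrite mulf_eq0 oppr_eq0 pnatr_eq0 gtn_eqF //=.
rewrite dual_chain_low ?leqnn ?ltn_predL //; last first.
  by rewrite (leq_ltn_trans (leq_pred _)).
rewrite subnn fact0 divr1 !mulf_eq0 invr_eq0 signr_eq0 pnatr_eq0.
rewrite (negPf dual_chain_const_neq0) eqn0Ngt fact_gt0 /=.
move => /prodf_eq0[i _ /eqP].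
apply/eqP; rewrite -natrB ?leq_pred // -natrD pnatr_eq0; lia.
Qed.

Lemma dual_chain_krall i : (i < m)%N ->
  K i = krall_poly alpha (fun j => mcoord 0 (K j) / j`!%:R) i.+1 i.+1.
Proof.
move=> im; apply: mcoord_inj => k; rewrite mcoord_krall.
have ia : (i < alpha)%N := leq_trans im dual_chain_length.
have [ak|ka] := leqP alpha k; last first.
  by rewrite dual_chain_low // ltn_eqF ?add0r // ltn_addr.
by rewrite dual_chain_high // ifF ?addr0 //; apply/negbTE; lia.
Qed.
End Coordinates.
End DualChain.

(** * The theorem *)

(** If binom(x + alpha, alpha) is in the span, then q_n(0) = 0 for n >= m,
    since the values L_k(0) are then a combination of the other rows. As
    c_n <> 0, the recurrence at x = 0 can be run backwards, down to the nonzero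
    constant q_0. *)
Lemma three_term_not_multichoose (R : realType) (m alpha : nat)
    (Rp : 'I_m -> {poly R})
    (Omega_neq0 : forall n : nat, Omega Rp n%:R != 0)
    (ttr : three_term_recurrence (laguerre_type alpha%:R Rp))
    (z : 'I_m -> R) :
  multichoose R alpha <> \sum_k z k *: Rp k.
Proof.
move=> bE; set q := laguerre_type alpha%:R Rp in ttr.
have q_large n : (m <= n)%N -> (q n).[0] = 0.
  move=> mn; rewrite /q laguerre_typeE horner_sum.
  transitivity
      (\sum_j cas_cofactor Rp n j * (multichoose R alpha).[n%:R - j%:R]).
    apply: eq_bigr => j _.
    have jn : (j <= n)%N by apply: leq_trans mn; rewrite -ltnS.
    by rewrite hornerZ subzn // laguerre_at0 natrB.
  rewrite bE; under eq_bigr => j _ do rewrite horner_sum mulr_sumr.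
  rewrite exchange_big big1 // => l _.
  under eq_bigr => j _ do rewrite hornerZ mulrCA.
  by rewrite -mulr_sumr cas_cofactor_annihil mulr0.
have [a [b [c [c0 ttrE]]]] := ttr.
have q_back n : (q n.+1).[0] = 0 -> (q n.+2).[0] = 0 -> (q n).[0] = 0.
  move=> q1 q2; have /(congr1 (horner^~ 0)) := ttrE n.+1.
  rewrite hornerM hornerX mul0r !hornerD !hornerZ q1 q2 !mulr0 !add0r.
  by move/esym/eqP; rewrite mulf_eq0 (negPf (c0 n.+1 _)) //= => /eqP.
have q_all d n : (m <= n + d)%N -> (q n).[0] = 0.
  elim: d n => [|d IHd] n mn; first by rewrite q_large // -[n]addn0.
  by apply: q_back; apply: IHd; lia.
have sq0 : size (q 0%N) = 1%N by exact: size_laguerre_type.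
have q0C := size1_polyC (eq_leq sq0).
have := q_all m 0%N (leqnn m); rewrite q0C hornerC => q00.
by move: sq0; rewrite q0C q00 size_poly0.
Qed.

Lemma three_term_krall_form (R : realType) (m : nat) (g : 'I_m -> nat)
  (Rp Rr : 'I_m -> {poly R}) (alpha : nat)
  (m_ge1 : (1 <= m)%N)
  (g_gt0 : forall l : 'I_m, (0 < g l)%N)
  (g_incr : forall k l : 'I_m, (k < l)%N -> (g k < g l)%N)
  (Rp_deg : forall l : 'I_m, size (Rp l) = (g l).+1)
  (Rp_lead : forall l : 'I_m, lead_coef (Rp l) = ((g l)`!%:R)^-1)
  (alpha_gt0 : (0 < alpha)%N)
  (Omega_neq0 : forall n : nat, Omega Rp n%:R != 0)
  (Rr_reduced : reduced_representation g Rp Rr) :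
  three_term_recurrence (laguerre_type alpha%:R Rp) ->
  krall_laguerre_form g alpha Rr.
Proof.
(* The families are indexed by all natural numbers, by means of a default
   index, in order to speak of initial spans. *)
move=> ttr; pose o k : 'I_m := insubd (Ordinal m_ge1) k.
pose r k := Rp (o k); pose g' k := g (o k).
have oE (l : 'I_m) : o l = l by exact: valKd.
have oK k : (k < m)%N -> o k = k :> nat by move=> km; rewrite /o val_insubd km.
have spanE (z : 'I_m -> R) (P : pred 'I_m) h :
    (h <= m)%N -> P =1 (fun k => (k < h)%N) ->
    in_span r h (\sum_(k < m | P k) z k *: Rp k).
  move=> hm Ph; exists (fun k => z (o k)).
  rewrite (big_ord_widen m (fun k => z (o k) *: r k)) //.
  by apply: eq_big => // l _; rewrite /r oE.
have spanT (z : 'I_m -> R) : in_span r m (\sum_k z k *: Rp k).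
  by apply: spanE => // k; rewrite ltn_ord.
have g_gt0' l : (l < m)%N -> (0 < g' l)%N by move=> _; exact: g_gt0.
have g_incr' k l : (k < l)%N -> (l < m)%N -> (g' k < g' l)%N.
  by move=> kl lm; apply: g_incr; rewrite !oK // (ltn_trans kl).
have rS : staircase g' r m.
  move=> l lm; rewrite /r /g'; split=> [|k lk]; last first.
    by rewrite mcoord_eq0 // Rp_deg.
  rewrite mcoord_lead ?Rp_deg //.
  have := Rp_lead (o l); rewrite /lead_coef Rp_deg /= => ->.
  by rewrite divff // pnatr_eq0 -lt0n fact_gt0.
have rJ l : (l < m)%N -> in_span r m (dualx alpha%:R (r l)).
  by move=> _; have [z ->] := dualx_inspan Omega_neq0 ttr (o l).
have b_notin : ~ in_span r m (multichoose R alpha).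
  move=> [z bE].
  apply: (three_term_not_multichoose Omega_neq0 ttr (z := fun k => z k)).
  by rewrite bE; apply: eq_bigr => k _; rewrite /r oE.
have gE l : (l < m)%N -> g' l = (alpha + l)%N.
  exact: (dualx_degrees m_ge1 g_gt0' g_incr' rS rJ).
have [K Kc] : exists K, dual_chain alpha r m K.
  rewrite -(prednK m_ge1).
  apply: (dual_chain_exists m_ge1 g_gt0' g_incr' rS rJ).
  by rewrite prednK.
have m_alpha := dual_chain_length m_ge1 b_notin Kc alpha_gt0.
pose a j := mcoord 0 (K j) / j`!%:R.
have KE i : (i < m)%N -> K i = krall_poly alpha a i.+1 i.+1.
  exact: (dual_chain_krall m_ge1 b_notin Kc alpha_gt0).
split=> [l|_|am]; first by rewrite -{1}(oE l); exact: gE.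
  exists a; split.
    by rewrite /a fact0 divr1; exact: (dual_chain_const_neq0 m_ge1 b_notin Kc).
  have [[zeta RrE] Rr_coef] := Rr_reduced; split=> //.
  have /choice [xi xiE] l : exists y : 'I_m -> R, Rr l =
      krall_poly alpha a l.+1 l.+1
      + \sum_(k < m | (k < l)%N) y k *: krall_poly alpha a k.+1 k.+1.
    have lm := ltn_ord l.
    have [Kl K1 _ _] := Kc l lm.
    have RrS : in_span r l (Rr l - r l).
      by rewrite RrE /r oE addrAC subrr add0r; apply: spanE => //; exact: ltnW.
    have RrS' : in_span r l.+1 (Rr l).
      rewrite -(subrK (r l) (Rr l)) addrC -[r l]scale1r.
      apply: in_spanD; first exact: in_span_gen.
      by rewrite scale1r; exact: in_spanS RrS.
    have RrK : in_span r l (Rr l - K l).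
      apply: (staircase_truncate rS g_incr' (leqnSn l) lm) => [|k lk kl].
        by rewrite addrC -scaleN1r; exact: in_spanD.
      have -> : k = l :> nat by apply/eqP; rewrite eqn_leq lk -ltnS kl.
      rewrite -(subrK (r l) (Rr l)) linearB linearD /=.
      rewrite (staircase_mcoord0 rS (ltnW lm) _ RrS); last first.
        by move=> i il; exact: g_incr'.
      by rewrite add0r (rS l lm).1 gE // K1 subrr.
    have [z zE] := dual_chain_span m_ge1 g_gt0' g_incr' rS rJ (leqnn m) Kc
      (ltnW lm) RrK.
    exists (fun k => z k).
    rewrite -(KE l lm) -[LHS](subrK (K l)) zE addrC; congr (_ + _).
    rewrite (big_ord_widen m (fun k => z k *: K k) (ltnW lm)).
    by apply: eq_bigr => k _; rewrite KE.
  by exists xi.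
by have := leq_trans m_alpha am; rewrite leqNgt subn1 ltn_predL m_ge1.
Qed.

Theorem theorem5p5 (R : realType) (m : nat) (g : 'I_m -> nat)
  (Rp Rr : 'I_m -> {poly R}) (alpha : nat)
  (m_ge1 : (1 <= m)%N)
  (g_gt0 : forall l : 'I_m, (0 < g l)%N)
  (g_incr : forall k l : 'I_m, (k < l)%N -> (g k < g l)%N)
  (Rp_deg : forall l : 'I_m, size (Rp l) = (g l).+1)
  (Rp_lead : forall l : 'I_m, lead_coef (Rp l) = ((g l)`!%:R)^-1)
  (alpha_gt0 : (0 < alpha)%N)
  (alpha_le : (alpha <= \max_(l < m) g l)%N)
  (Omega_neq0 : forall n : nat, Omega Rp n%:R != 0)
  (Rr_reduced : reduced_representation g Rp Rr) :
  (three_term_recurrence (laguerre_type alpha%:R Rp) ->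
     krall_laguerre_form g alpha Rr) /\
  (~ krall_laguerre_form g alpha Rr ->
     ~ orthogonal_wrt_measure (laguerre_type alpha%:R Rp)).
Proof.
have form := three_term_krall_form m_ge1 g_gt0 g_incr Rp_deg Rp_lead alpha_gt0
  Omega_neq0 Rr_reduced.
split=> // no_form orth; apply/no_form/form.
by apply: orthogonal_wrt_measure_three_term orth; exact: size_laguerre_type.
Qed.
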